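(* Assume (A1)–(A4) and $(RC_+)$. Then the Markovian strategy $\pi_t^+:=\mathbf{1}_{R^+}(X_{t-1})$, $t\ge1$, generates an asymptotic exponential arbitrage with geometrically decaying probability of failure: there are constants $b>0$ and $c>0$ such that $\mathbb{P}(V_t^{\pi^+}\ge e^{bt})\ge 1-e^{-ct}$ for all sufficiently large $t$.
   Context: Setting: $\mu,\sigma:\mathbb{R}\to\mathbb{R}$ are measurable, $(\varepsilon_t)_{t\ge1}$ are i.i.d. real random variables on $(\Omega,\mathcal{F},\mathbb{P})$, $X_0\in\mathbb{R}$ is a constant, and $X_t=X_{t-1}+\mu(X_{t-1})+\sigma(X_{t-1})\varepsilon_t$ for $t\ge1$. The (discounted) stock price is $S_t=e^{X_t}$ and $\mathcal{F}_t=\sigma(X_s,0\le s\le t)$. Assumptions: (A1) $\varepsilon_1$ has a density $\gamma$ w.r.t. Lebesgue measure $\lambda$ which is bounded and bounded away from $0$ on each compact subset of $\mathbb{R}$; (A2) $\mu$ is locally bounded, $\sigma$ is positive, bounded away from $0$ on each compact set and globally bounded; (A3) $\limsup_{|x|\to\infty}|x+\mu(x)|/|x|<1$; (A4) there is $\kappa>0$ with $\mathbb{E}e^{\kappa\varepsilon_1^2}<\infty$, and $\mathbb{E}\varepsilon_1=0$. Condition $(RC_+)$: the set $R^+:=\{x\in\mathbb{R}:\mu(x)>0\}$ has $\lambda(R^+)>0$. A trading strategy is an $(\mathcal{F}_t)$-predictable $[0,1]$-valued process $(\pi_t)_{t\ge1}$ ($\pi_t$ is $\mathcal{F}_{t-1}$-measurable);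 its wealth process is $V_0^\pi=V_0>0$ and $V_t^\pi=V_{t-1}^\pi\big((1-\pi_t)+\pi_t S_t/S_{t-1}\big)$, $t\ge1$. *)

(* Defs.v *)
From HB Require Import structures.
From mathcomp Require Import all_boot all_order all_algebra.
From mathcomp Require Import all_classical all_reals all_analysis.
Set Implicit Arguments. Unset Strict Implicit. Unset Printing Implicit Defensive.
Import Order.TTheory GRing.Theory Num.Theory.
Import numFieldNormedType.Exports.
Local Open Scope classical_set_scope.
Local Open Scope ring_scope.

Section Model.
Context {R : realType} {d : measure_display} {T : measurableType d}.

Definition mutually_independent (P : probability T R) (I : set nat)
  (e : nat -> T -> R) : Prop :=
  forall (s : seq nat), uniq s -> {in s, forall i, I i} ->
  forall (A : nat -> set R), (forall i, measurable (A i)) ->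
  P (\big[setI/setT]_(i <- s) (e i @^-1` A i)) =
  (\prod_(i <- s) P (e i @^-1` A i))%E.

Definition iid_from1 (P : probability T R) (e : nat -> T -> R) : Prop :=
  (forall t, (0 < t)%N -> measurable_fun setT (e t)) /\
  mutually_independent P [set t | (0 < t)%N] e /\
  (forall t, (0 < t)%N -> forall A : set R, measurable A ->
      P (e t @^-1` A) = P (e 1%N @^-1` A)).

Definition is_density (P : probability T R) (Y : T -> R) (gamma : R -> R) : Prop :=
  measurable_fun setT gamma /\ (forall x, 0 <= gamma x) /\
  forall A : set R, measurable A ->
    P (Y @^-1` A) = (\int[lebesgue_measure]_(x in A) (gamma x)%:E)%E.

Fixpoint Xproc (mu sigma : R -> R) (e : nat -> T -> R) (x0 : R) (t : nat) : T -> R :=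
  match t with
  | 0%N => fun _ => x0
  | t'.+1 => fun w =>
      let x := Xproc mu sigma e x0 t' w in x + mu x + sigma x * e t w
  end.

Definition Sproc (X : nat -> T -> R) (t : nat) : T -> R := fun w => expR (X t w).

(* Wealth of the strategy pi (pi t is used on the period (t-1, t], t >= 1):
   V_0 = v0, V_t = V_{t-1} ((1 - pi_t) + pi_t S_t / S_{t-1}). *)
Fixpoint wealth (S : nat -> T -> R) (pi : nat -> T -> R) (v0 : R) (t : nat) : T -> R :=
  match t with
  | 0%N => fun _ => v0
  | t'.+1 => fun w =>
      wealth S pi v0 t' w * ((1 - pi t w) + pi t w * (S t w / S t' w))
  end.

Definition pi_plus (mu : R -> R) (X : nat -> T -> R) (t : nat) : T -> R :=
  fun w => if 0 < mu (X t.-1 w) then 1 else 0.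

End Model.

(* Main.v *)
Require Import Defs.
From HB Require Import structures.
From mathcomp Require Import all_boot all_order all_algebra.
From mathcomp Require Import all_classical all_reals all_analysis.
From mathcomp Require Import measurable_realfun.
From mathcomp Require Import ring lra.
Import Order.TTheory GRing.Theory Num.Theory.
Import numFieldNormedType.Exports.
Local Open Scope classical_set_scope.
Local Open Scope ring_scope.

(** Choose [delta > 0] and a bounded set [A] of positive Lebesgue measure on
    which [mu > delta]. Then [log V_t >= log v0 + delta * N_t + L_t], where
    [N_t] counts the visits of [X] to [A] before time [t] and [L_t] is the sum
    of the noise terms [sigma(X_{k-1}) eps_k] over the periods in which the
    stock is held. Both [N_t] and [L_t] are controlled by Chernoff bounds.
    - The function [W = 1 - 1_A / 4 + beta e^|x|] satisfies
      [E (e^{- 1_A(x)} W(X_1) | X_0 = x) <= rho W(x)] with [rho < 1]: on [A] by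
      the factor [1/e], far away by (A3), and in between because [A] is hit in
      one step with probability bounded below. Hence [N_t >= a t] outside an
      event of geometrically small probability.
    - As [eps] is centred with a Gaussian moment, [E e^{u eps} <= 1 + C u^2]
      for small [u], so [L_t >= - a delta t / 2] outside another such event. *)

(** * Chains driven by i.i.d. noise *)

(** The state space is abstract so that it can later be a pair: the log-price together with a
    running sum. *)
Fixpoint chain {R : realType} {d d' : measure_display} {T : measurableType d}
    {S : measurableType d'} (Phi : S * R -> S) (z0 : S) (e : nat -> T -> R)
    (t : nat) : T -> S :=
  match t with
  | 0%N => fun=> z0
  | t'.+1 => fun w => Phi (chain Phi z0 e t' w, e t w)
  end.

Section chain_theory.
Context {R : realType} {d d' : measure_display} {T : measurableType d}
  {S : measurableType d'} (P : probability T R).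
Context {Phi : S * R -> S} (z0 : S) {e : nat -> T -> R}.
Context (mPhi : measurable_fun setT Phi) (iid : iid_from1 P e).

Local Notation Z := (chain Phi z0 e).

Lemma measurable_chain t : measurable_fun setT (Z t).
Proof.
elim: t => [|t IH] /=; first exact: measurable_cst.
apply: (measurableT_comp mPhi).
by apply: measurable_fun_pair => //; exact: iid.1.
Qed.

Let measurable_cyl (s : seq nat) (B : nat -> set R) :
  {in s, forall i, (0 < i)%N} -> (forall i, measurable (B i)) ->
  measurable (\big[setI/setT]_(i <- s) (e i @^-1` B i)).
Proof.
move=> s0 mB; rewrite big_seq; apply: bigsetI_measurable => i /s0 i0.
by rewrite -[X in measurable X]setTI; apply: iid.1.
Qed.

(* The induction on [t] needs the whole future rectangle: the step merges [eps_{t+1}]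
   into the state and uses uniqueness of the product measure. *)
Lemma chain_indep_future t (A : set S) (s : seq nat) (B : nat -> set R) :
  measurable A -> uniq s -> {in s, forall i, (t < i)%N} ->
  (forall i, measurable (B i)) ->
  P (Z t @^-1` A `&` \big[setI/setT]_(i <- s) (e i @^-1` B i)) =
  (P (Z t @^-1` A) * \prod_(i <- s) P (e i @^-1` B i))%E.
Proof.
elim: t A s B => [|t IH] A s B mA us st mB /=.
  have PB : P (\big[setI/setT]_(i <- s) (e i @^-1` B i)) =
     (\prod_(i <- s) P (e i @^-1` B i))%E by apply: iid.2.1.
  have [Az|Az] := pselect (A z0).
    have -> : (fun=> z0) @^-1` A = [set: T] by apply/seteqP; split.
    by rewrite setTI probability_setT mul1e.
  have -> : (fun=> z0) @^-1` A = set0 :> set T by apply/seteqP; split.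
  by rewrite set0I measure0 mul0e.
set E := \big[setI/setT]_(i <- s) _.
have s0 : {in s, forall i, (0 < i)%N} by move=> i /st; exact: leq_trans.
have mE : measurable E by exact: measurable_cyl.
have mt : measurable_fun setT (e t.+1) by exact: iid.1.
have PE : P E = (\prod_(i <- s) P (e i @^-1` B i))%E by apply: iid.2.1.
pose c : {nonneg R} := NngNum (fine_ge0 (measure_ge0 P E)).
have cE : c%:num%:E = P E.
  by rewrite /c /= fineK// fin_num_measure.
have mZe : measurable_fun setT (fun w => (Z t w, e t.+1 w)).
  by apply: measurable_fun_pair => //; exact: measurable_chain.
pose Zt : {mfun T >-> S} := mfun_Sub (mem_set (measurable_chain t)).
pose et : {mfun T >-> R} := mfun_Sub (mem_set mt).
pose Ze : {mfun T >-> (S * R)%type} := mfun_Sub (mem_set mZe).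
(* [m1] is the law of [(Z_t, eps_{t+1})] restricted to the event [E], and [m2] is the full law
   scaled by [P E]. Their equality says that the pair is independent of [E]. *)
have [m1 m1E] : exists m1 : measure (S * R)%type R,
    forall X, m1 X = P ((fun w => (Z t w, e t.+1 w)) @^-1` X `&` E).
  unshelve eexists; first by refine (pushforward (mrestr P mE) Ze : measure _ _).
  by [].
pose m2 := [the measure _ _ of mscale c (distribution P Ze)].
(* The factor [P E] is carried by [n2], so that [m1] and [m2] both agree with [n1 x n2] on
   rectangles. *)
pose n1 := [the {sigma_finite_measure set S -> \bar R} of distribution P Zt].
pose n2 := [the {sigma_finite_measure set R -> \bar R} of mscale c (distribution P et)].
have rect (A' : set S) (B' : set R) : measurable A' -> measurable B' ->
    P (Z t @^-1` A' `&` e t.+1 @^-1` B') =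
    (P (Z t @^-1` A') * P (e t.+1 @^-1` B'))%E.
  move=> mA' mB'.
  have := IH A' [:: t.+1] (fun=> B') mA' isT _ (fun=> mB').
  rewrite !big_seq1; apply=> i; rewrite inE => /eqP ->; exact: ltnSn.
have rectE (A' : set S) (B' : set R) : measurable A' -> measurable B' ->
    P (Z t @^-1` A' `&` e t.+1 @^-1` B' `&` E) =
    (P (Z t @^-1` A') * P (e t.+1 @^-1` B') * P E)%E.
  move=> mA' mB'.
  have tNs : t.+1 \notin s by apply/negP => /st; rewrite ltnn.
  (* The constraint on [eps_{t+1}] is one more future coordinate as seen from time [t]; since [t.+1]
     is not in [s], the other sides of the rectangle are unchanged. *)
  have := IH A' (t.+1 :: s) (fun i => if i == t.+1 then B' else B i) mA'.
  rewrite /= tNs us => /(_ isT).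
  have eqN i : i \in s -> (if i == t.+1 then B' else B i) = B i.
    by move=> si; case: eqP => // it; rewrite -it si in tNs.
  rewrite !big_cons eqxx setIA => H.
  rewrite /E PE -muleA.
  under eq_big_seq do rewrite -eqN//.
  under [in RHS]eq_big_seq do rewrite -eqN//.
  rewrite H//.

  - by move=> i; rewrite inE => /orP[/eqP ->//|/st]; exact: ltnW.
  - by move=> i; case: ifP.
have m12 : forall X, measurable X -> m1 X = m2 X.
  move=> X mX.
  rewrite -(@product_measure_unique _ _ _ _ _ n1 n2 m1) //; last first.
    move=> A' B' mA' mB'; rewrite m1E.
    rewrite (rectE A' B')//.
    by rewrite -muleA [X in (_ * X)%E]muleC -cE.
  rewrite -(@product_measure_unique _ _ _ _ _ n1 n2 m2) //.
  move=> A' B' mA' mB'; rewrite /m2 /= /mscale /= /pushforward.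
  transitivity (c%:num%:E * P (Z t @^-1` A' `&` e t.+1 @^-1` B'))%E => //.
  rewrite rect//.
  by rewrite muleCA.
have := m12 (Phi @^-1` A); rewrite -[X in measurable X]setTI => /(_ (mPhi _ _ mA)) //.
rewrite m1E /m2 /= /mscale /pushforward /= cE PE muleC.
by apply.
Qed.



(** The law of [(Z_t, eps_{t+1})] is a product, so Tonelli integrates the noise first, at a frozen
    state, where the drift inequality applies. This takes the place of conditioning on the past. *)
Lemma chain_integral_step t (H : S -> R) (rho : R) :
  measurable_fun setT H -> (forall z, 0 <= H z) -> 0 <= rho ->
  (forall z, (\int[P]_w (H (Phi (z, e 1%N w)))%:E <= (rho * H z)%:E)%E) ->
  (\int[P]_w (H (Z t.+1 w))%:E <= rho%:E * \int[P]_w (H (Z t w))%:E)%E.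
Proof.
move=> mH H0 rho0 drift.
have me i : (0 < i)%N -> measurable_fun setT (e i) by exact: iid.1.
have mZe : measurable_fun setT (fun w => (Z t w, e t.+1 w)).
  by apply: measurable_fun_pair; [exact: measurable_chain|exact: me].
pose Zt : {mfun T >-> S} := mfun_Sub (mem_set (measurable_chain t)).
pose et : {mfun T >-> R} := mfun_Sub (mem_set (me t.+1 isT)).
pose e1 : {mfun T >-> R} := mfun_Sub (mem_set (me 1%N isT)).
pose Ze : {mfun T >-> (S * R)%type} := mfun_Sub (mem_set mZe).
pose n1 := [the {sigma_finite_measure set S -> \bar R} of distribution P Zt].
pose n2 := [the {sigma_finite_measure set R -> \bar R} of distribution P et].
have mHP : measurable_fun setT (EFin \o (fun x => H (Phi x))).
  by apply/measurable_EFinP; exact: measurableT_comp.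
have mHZ i : measurable_fun setT (EFin \o (fun w => H (Z i w))).
  by apply/measurable_EFinP; apply: measurableT_comp => //; exact: measurable_chain.
have HE0 x : (0%R <= (H (Phi x))%:E)%E by rewrite lee_fin.
have -> : (\int[P]_w (H (Z t.+1 w))%:E =
    \int[distribution P Ze]_x (H (Phi x))%:E)%E.
  by rewrite ge0_integral_distribution.
rewrite (eq_measure_integral (n1 \x n2)%E); last first.
  move=> X mX _; apply/esym; apply: product_measure_unique => // A' B' mA' mB'.
  have := @chain_indep_future t A' [:: t.+1] (fun=> B') mA' isT _ (fun=> mB').
  rewrite !big_seq1; apply=> i; rewrite inE => /eqP ->; exact: ltnSn.
rewrite fubini_tonelli1//.
have mHe : measurable_fun setT (EFin \o (fun z : S => H z)) by apply/measurable_EFinP.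
rewrite -(ge0_integralZl P measurableT (mHZ t))//; last first.
  by move=> w _; rewrite lee_fin.
rewrite -(@ge0_integral_distribution _ _ _ _ _ P Zt (fun z => (rho%:E * (H z)%:E)%E)); last 2 first.
- exact: measurable_funeM.
- by move=> z; rewrite lee_fin mulr_ge0.
apply: ge0_le_integral => //.
- by move=> z _; apply: integral_ge0.
- exact: measurable_fun_fubini_tonelli_F.
- exact: measurable_funeM.
move=> z _; rewrite -EFinM; apply: le_trans (drift z); rewrite /fubini_F.
have mz : measurable_fun setT (EFin \o (fun y => H (Phi (z, y)))).
  by apply: (measurableT_comp mHP); exact: measurable_pair1.
(* The drift is assumed for [eps_1] only; identical distribution transfers it to [eps_{t+1}]. *)
rewrite (eq_measure_integral (distribution P e1)) ?ge0_integral_distribution//.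
by move=> A mA _; apply: iid.2.2.
Qed.

Lemma chain_integral_geometric t (H : S -> R) (rho : R) :
  measurable_fun setT H -> (forall z, 0 <= H z) -> 0 <= rho ->
  (forall z, (\int[P]_w (H (Phi (z, e 1%N w)))%:E <= (rho * H z)%:E)%E) ->
  (\int[P]_w (H (Z t w))%:E <= (rho ^+ t * H z0)%:E)%E.
Proof.
move=> mH H0 rho0 drift; elim: t => [|t IH].
  rewrite [leLHS](integral_cst P measurableT (H z0)%:E).
  by rewrite [X in (_ * X)%E]probability_setT mule1 expr0 mul1r.
apply: le_trans (chain_integral_step t H rho mH H0 rho0 drift) _.
by rewrite exprS -mulrA EFinM lee_wpmul2l.
Qed.

End chain_theory.

(** * Gaussian moments *)

Section exponential_inequalities.
Context {R : realType}.
Implicit Types x y : R.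

(** For [x > 1/2], [x <= 3 x^2] suffices. Otherwise [e^x <= 1 / (1 - x) <= 1 + x + 3 x^2]. The
    linear term is kept apart because it vanishes in the mean for centred noise. *)
Lemma expR_le_D_sqr x : expR x <= x + expR (3 * x ^+ 2).
Proof.
have [xh|xh] := lerP x 2^-1; last first.
  have : expR x <= expR (3 * x ^+ 2) by rewrite ler_expR; nra.
  by have := xh; lra.
have x1 : 0 < 1 - x by lra.
have e1 : expR x * (1 - x) <= 1.
  have := expR_ge1Dx (- x).
  rewrite -(ler_pM2l (expR_gt0 x)) expRxMexpNx_1.
  by apply: le_trans.
have e2 : expR x <= 1 + x + 3 * x ^+ 2.
  by rewrite -(ler_pM2r x1); apply: le_trans e1 _; nra.
by have := expR_ge1Dx (3 * x ^+ 2); lra.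
Qed.

Lemma expR_chord (l y : R) : 0 <= l <= 1 -> expR (l * y) <= 1 - l + l * expR y.
Proof.
move=> /andP[l0 l1]; have el := expR_gt0 (l * y).
(* tangent lines of [expR] at [l * y], evaluated at [y] and at [0] *)
have h1 : expR (l * y) * (1 + (1 - l) * y) <= expR y.
  have -> : y = l * y + (1 - l) * y by ring.
  rewrite [leRHS]expRD -(_ : (1-l)*y = (1 - l) * (l * y + (1 - l) * y)); last by ring.
  have -> : l * (l * y + (1 - l) * y) = l * y by ring.
  by rewrite ler_pM2l// expR_ge1Dx.
have h2 : expR (l * y) * (1 - l * y) <= 1.
  rewrite -[leRHS](expRxMexpNx_1 (l * y)) ler_pM2l//; exact: expR_ge1Dx.
(* Weighting [h1] by [l] and [h2] by [1 - l] cancels the terms linear in [y]. *)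
nra.
Qed.

End exponential_inequalities.

Section gaussian_moments.
Context {R : realType} {d : measure_display} {T : measurableType d}.
Context (P : probability T R) (Y : T -> R) (kappa K : R).
Context (mY : measurable_fun setT Y) (kappa0 : 0 < kappa)
  (YK : (\int[P]_w (expR (kappa * Y w ^+ 2))%:E <= K%:E)%E).

Lemma measurable_EFin_expR (f : T -> R) : measurable_fun setT f ->
  measurable_fun setT (fun w => (expR (f w))%:E).
Proof. by move=> mf; apply/measurable_EFinP; exact: measurableT_comp. Qed.

Let mYsq (c : R) : measurable_fun setT (fun w => c * Y w ^+ 2).
Proof. by apply: measurable_funM => //; apply: measurable_funX. Qed.

Let integrable_gauss : P.-integrable setT (fun w => (expR (kappa * Y w ^+ 2))%:E).
Proof.
apply/integrableP; split; first exact: measurable_EFin_expR.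
under eq_integral do rewrite gee0_abs ?lee_fin ?expR_ge0//.
exact: le_lt_trans YK (ltry _).
Qed.

Let integrable_Y : P.-integrable setT (EFin \o Y).
Proof.
(* Domination: [|Y| <= 1 + Y^2], where [1 <= e^(kappa Y^2)] and [Y^2 <= kappa^-1 e^(kappa Y^2)]. *)
pose c := 1 + kappa^-1.
apply: (@le_integrable _ _ _ _ _ measurableT _
   (fun w => (c%:E * (expR (kappa * Y w ^+ 2))%:E)%E)).
- exact/measurable_EFinP.
- move=> w _; rewrite -EFinM /= lee_fin.
  have k0 : 0 < kappa^-1 by rewrite invr_gt0.
  have e0 := expR_gt0 (kappa * Y w ^+ 2).
  rewrite [leRHS]ger0_norm; last by rewrite /c; nra.
  have e1 := expR_ge1Dx (kappa * Y w ^+ 2).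
  have e2 : 0 <= kappa * Y w ^+ 2 by rewrite mulr_ge0 ?sqr_ge0// ltW.
  have e3 : Y w ^+ 2 <= kappa^-1 * expR (kappa * Y w ^+ 2).
    by rewrite -(ler_pM2l kappa0) [leRHS]mulrA divff ?gt_eqF// mul1r; lra.
  have : `|Y w| <= 1 + Y w ^+ 2.
    by rewrite -[Y w ^+ 2]real_normK ?num_real//; nra.
  rewrite /c mulrDl; lra.
- exact: integrableZl.
Qed.

(** Integrate [e^(uY) <= uY + e^(3 u^2 Y^2)]: the mean kills the first term. With
    [l = 3 u^2 / kappa <= 1], convexity bounds the second by [1 - l + l e^(kappa Y^2)], which makes
    the excess over 1 quadratic in [u]. *)
Lemma mgf_le (u : R) : ('E_P[Y] = 0)%E -> 3 * u ^+ 2 <= kappa ->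
  (\int[P]_w (expR (u * Y w))%:E <= (1 + 3 * u ^+ 2 / kappa * K)%:E)%E.
Proof.
rewrite unlock => EY uk; pose l := 3 * u ^+ 2 / kappa.
have l01 : 0 <= l <= 1.
  apply/andP; split; last by rewrite /l ler_pdivrMr// mul1r.
  by apply: divr_ge0; [exact: mulr_ge0 (sqr_ge0 _)|exact: ltW].
have l0 : 0 <= l by case/andP: l01.
pose g w : \bar R := (u%:E * (Y w)%:E + ((1 - l)%:E + l%:E * (expR (kappa * Y w ^+ 2))%:E))%E.
have ic : P.-integrable setT (fun w => (1 - l)%:E : \bar R).
  exact: finite_measure_integrable_cst.
have i1 : P.-integrable setT (fun w => (u%:E * (Y w)%:E)%E) by exact: integrableZl.
have i2 : P.-integrable setT (fun w => (l%:E * (expR (kappa * Y w ^+ 2))%:E)%E).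
  exact: integrableZl.
have ig : P.-integrable setT g by apply: integrableD => //; apply: integrableD.
have le w : ((expR (u * Y w))%:E <= g w)%E.
  rewrite /g -!EFinM -!EFinD lee_fin.
  apply: le_trans (expR_le_D_sqr _) _; rewrite lerD2l.
  have -> : 3 * (u * Y w) ^+ 2 = l * (kappa * Y w ^+ 2).
    by rewrite /l; field; rewrite gt_eqF.
  exact: expR_chord.
apply: (@le_trans _ _ (\int[P]_w g w)%E).
  apply: le_integral => //.
  apply: (le_integrable _ _ _ ig) => //.
    by apply: measurable_EFin_expR; exact: measurable_funM.
  move=> w _; rewrite gee0_abs ?lee_fin ?expR_ge0//.
  exact: le_trans (le w) (lee_abs _).
rewrite integralD//; last by apply: integrableD.
rewrite integralZl// EY mule0 add0e integralD// integralZl//.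
rewrite [X in (X + _)%E](integral_cst P measurableT (1 - l)%:E) [X in (_ * X)%E]probability_setT mule1.
rewrite [leRHS]EFinD; apply: leeD; first by rewrite lee_fin; lra.
by rewrite [leRHS]EFinM lee_wpmul2l.
Qed.

(** Completing the square gives [M |Y| <= M^2 / (4 kappa) + kappa Y^2]. *)
Lemma exp_abs_moment_le (M : R) :
  (\int[P]_w (expR (M * `|Y w|))%:E <= (expR (M ^+ 2 / (4 * kappa)) * K)%:E)%E.
Proof.
apply: (@le_trans _ _ (\int[P]_w ((expR (M ^+ 2 / (4 * kappa)))%:E * (expR (kappa * Y w ^+ 2))%:E))%E).
  apply: ge0_le_integral => //.
  - by apply: measurable_EFin_expR; apply: measurable_funM => //; exact: measurableT_comp.
  - by apply: measurable_funeM; exact: measurable_EFin_expR.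
  move=> w _; rewrite -EFinM -expRD lee_fin ler_expR.
  have -> : M ^+ 2 / (4 * kappa) + kappa * Y w ^+ 2 =
     M * `|Y w| + kappa^-1 * (kappa * `|Y w| - M / 2) ^+ 2.
    by rewrite -[Y w ^+ 2]real_normK ?num_real//; field; rewrite gt_eqF.
  by rewrite lerDl mulr_ge0 ?sqr_ge0// invr_ge0 ltW.
rewrite ge0_integralZl//; last exact: measurable_EFin_expR.
by rewrite [leRHS]EFinM lee_wpmul2l// lee_fin expR_ge0.
Qed.

End gaussian_moments.

(** * Hitting probabilities *)

Section measurable_sets.
Context {R : realType} {d : measure_display} {T : measurableType d}.

Lemma measurable_setlt (f g : T -> R) :
  measurable_fun setT f -> measurable_fun setT g -> measurable [set w | f w < g w].
Proof.
move=> mf mg; rewrite -[X in measurable X]setTI.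
exact: (measurable_fun_ltr mf mg measurableT (Y := [set true])).
Qed.

Lemma measurable_setle (f g : T -> R) :
  measurable_fun setT f -> measurable_fun setT g -> measurable [set w | f w <= g w].
Proof.
by move=> mf mg; rewrite -[X in measurable X]setTI; exact: measurable_fun_le.
Qed.

End measurable_sets.

Section hitting.
Context {R : realType}.
Implicit Types (a s : R) (A : set R).

Lemma measurable_affine a s : measurable_fun setT (fun y : R => (a + s * y)%R).
Proof.
by apply: measurable_funD => //; exact: measurable_funM.
Qed.

(** The right-hand side is a measure in [A] that gives half-open intervals their length, so
    uniqueness of Lebesgue measure applies. *)
Lemma lebesgue_measure_affine_preimage a s A : 0 < s -> measurable A ->
  lebesgue_measure A = (s%:E * lebesgue_measure ((fun y : R => (a + s * y)%R) @^-1` A))%E.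
Proof.
move=> s0 mA.
pose f : R -> measurableTypeR R := fun y => a + s * y.
have mf : measurable_fun setT f by exact: measurable_affine.
have [m mE] : exists m : {measure set (measurableTypeR R) -> \bar R},
    forall X, m X = (s%:E * lebesgue_measure (f @^-1` X))%E.
  unshelve eexists.
    by unshelve refine (mscale (NngNum (ltW s0)) (pushforward lebesgue_measure f)).
  by [].
rewrite -mE; apply: lebesgue_measure_unique => // _ [[u v] _ <-].
rewrite mE /f /=.
have -> : (fun y : R => (a + s * y)%R) @^-1` `]u, v] = `](u - a) / s, (v - a) / s]%classic.
  apply/seteqP; split=> y /=; rewrite !in_itv/= ltr_pdivrMr// ler_pdivlMr//;
    by move=> /andP[uy yv]; apply/andP; split; lra.
rewrite !lebesgue_measure_itv/= !lte_fin ltr_pM2r ?invr_gt0// ltrD2r.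
case: ifPn => uv; last by rewrite mule0.
by rewrite -!EFinD -EFinM; congr (_%:E); field; rewrite gt_eqF.
Qed.

Context {d : measure_display} {T : measurableType d}.

Lemma density_lower_bound (P : probability T R) (Y : T -> R) (gamma : R -> R)
    (m : R) A : is_density P Y gamma -> measurable A -> 0 <= m ->
  (forall y, A y -> m <= gamma y) ->
  (m%:E * lebesgue_measure A <= P (Y @^-1` A))%E.
Proof.
move=> [mg [g0 gP]] mA m0 mle; rewrite gP// -integral_cst//.
apply: ge0_le_integral => //.
  by apply/measurable_EFinP; apply: measurable_funTS.
Qed.

(** On [A] the density of [a + s Y] is at least [m / s], hence at least [m / b]; the bound no longer
    depends on [a] and [s]. *)
Lemma affine_hitting_lower_bound (P : probability T R) (Y : T -> R)
    (gamma : R -> R) (m a s b : R) A :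
  is_density P Y gamma -> measurable A -> 0 <= m -> 0 < s <= b ->
  (forall y, A (a + s * y) -> m <= gamma y) ->
  ((m / b)%:E * lebesgue_measure A <= P [set w | A (a + s * Y w)%R])%E.
Proof.
move=> dY mA m0 /andP[s0 sb] mle; have b0 := lt_le_trans s0 sb.
have mA' : measurable ((fun y : R => (a + s * y)%R) @^-1` A).
  by rewrite -[X in measurable X]setTI; exact: measurable_affine.
apply: le_trans (@density_lower_bound P Y gamma m _ dY mA' m0 mle).
rewrite (@lebesgue_measure_affine_preimage a s A s0 mA) muleA -EFinM.
apply: lee_wpmul2r => //; rewrite lee_fin.
by rewrite mulrAC ler_pdivrMr// ler_wpM2l.
Qed.

(** The set where [mu > 0] is a countable union of the bounded sets [F k], which cannot all be
    null. *)
Lemma level_set_pos (mu : R -> R) : measurable_fun setT mu ->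
  (0 < lebesgue_measure [set x : R | (0 < mu x)%R])%E ->
  exists delta n : R, [/\ 0 < delta, 0 < n &
    (0 < lebesgue_measure [set x : R | (delta < mu x)%R /\ (`|x| <= n)%R])%E].
Proof.
move=> mmu pos.
pose F (k : nat) := [set x : R | k.+1%:R^-1 < mu x /\ `|x| <= k.+1%:R].
have mF k : measurable (F k).
  have -> : F k = [set x | k.+1%:R^-1 < mu x] `&` [set x | `|x| <= k.+1%:R].
    by [].
  apply: measurableI; first exact: measurable_setlt.
  by apply: measurable_setle => //; exact: measurableT_comp.
apply: contrapT => H.
have F0 k : lebesgue_measure (F k) = 0%E.
  apply/eqP; rewrite eq_le measure_ge0 andbT leNgt; apply/negP => Fk.
  by apply: H; exists k.+1%:R^-1, k.+1%:R; rewrite invr_gt0 ltr0n.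
have FU : \bigcup_k F k = [set x | 0 < mu x].
  apply/seteqP; split=> x /=.
    by move=> [k _ [+ _]]; apply: lt_trans; rewrite invr_gt0.
  (* This index exceeds both [1 / mu x] and [|x|]. *)
  move=> mux; exists (Num.bound ((mu x)^-1 + `|x|)) => //.
  have i0 : 0 < (mu x)^-1 by rewrite invr_gt0.
  have := archi_boundP (addr_ge0 (ltW i0) (normr_ge0 x)).
  set k := Num.bound _ => kb.
  have k1 : k%:R < k.+1%:R :> R by rewrite ltr_nat.
  have := normr_ge0 x => x0.
  split; last by lra.
  by rewrite invf_plt ?posrE//; lra.
have : lebesgue_measure [set x | (0 < mu x)%R] = 0%E.
  have mpos : measurable [set x | 0 < mu x] by exact: measurable_setlt.
  apply/(negligibleP lebesgue_measure mpos); rewrite -FU.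
  by apply: negligible_bigcup => k; apply/negligibleP; [exact: mF|exact: F0].
by move: pos => /[swap] ->; rewrite ltxx.
Qed.

Lemma markov_ge0 (P : probability T R) (f : T -> R) (a : R) :
  measurable_fun setT f -> (forall w, 0 <= f w) -> 0 < a ->
  (a%:E * P [set w | (a <= f w)%R] <= \int[P]_w (f w)%:E)%E.
Proof.
move=> mf f0 a0.
have mS : measurable [set w | a <= f w].
  exact: measurable_setle.
rewrite -(integral_cst P mS a%:E).
apply: (@le_trans _ _ (\int[P]_(w in [set w | (a <= f w)%R]) (f w)%:E)%E).
  apply: ge0_le_integral => //.
    by move=> w _; rewrite lee_fin ltW.
  by apply/measurable_EFinP; exact: measurable_funTS.
apply: ge0_subset_integral => //.
  exact/measurable_EFinP.
by move=> w _; rewrite lee_fin.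
Qed.
End hitting.

(** * Lyapunov function *)

Section drift.
Context {R : realType}.

(** This is [1 - 1_A / 4 + beta e^|y|], written with the complement of [A] so that for [beta >= 0]
    all summands are non-negative and the integral splits. *)
Definition lyapunov (A : set R) (beta : R) (y : R) : R :=
  3/4 + 1/4 * \1_(~` A) y + beta * expR `|y|.

Lemma lyapunov_in {A : set R} {beta y : R} : A y ->
  lyapunov A beta y = 3/4 + beta * expR `|y|.
Proof.
by move=> Ay; rewrite /lyapunov indicE memNset ?mulr0 ?addr0// => /(_ Ay).
Qed.

Lemma lyapunov_notin {A : set R} {beta y : R} : ~ A y ->
  lyapunov A beta y = 1 + beta * expR `|y|.
Proof. by move=> Ay; rewrite /lyapunov indicE mem_set//= mulr1; lra. Qed.

Lemma lyapunov_ge (A : set R) (beta y : R) : 0 <= beta -> 3/4 <= lyapunov A beta y.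
Proof.
move=> b0; rewrite /lyapunov -addrA lerDl addr_ge0//.
  by rewrite mulr_ge0.
Qed.

Lemma measurable_lyapunov (A : set R) (beta : R) : measurable A ->
  measurable_fun setT (lyapunov A beta).
Proof.
move=> mA; apply: measurable_funD; last first.
  by apply: measurable_funM => //; apply: measurableT_comp => //; exact: measurableT_comp.
apply: measurable_funD => //; apply: measurable_funM => //.
by apply: measurable_indic; exact: measurableC.
Qed.

Context {d : measure_display} {T : measurableType d} (P : probability T R).

(** Reaching [A] with probability at least [p] lowers the mean of the bounded part from 1 by at
    least [p / 4]. Taking [p = 0] serves starting points where only the exponential term is
    controlled. *)
Lemma lyapunov_integral_le (X : T -> R) (A : set R) (beta p u : R) :
  measurable_fun setT X -> measurable A -> 0 <= beta ->
  (p%:E <= P (X @^-1` A))%E -> (\int[P]_w (expR `|X w|)%:E <= u%:E)%E ->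
  (\int[P]_w (lyapunov A beta (X w))%:E <= (1 - p / 4 + beta * u)%:E)%E.
Proof.
move=> mX mA b0 pA Uu.
have mXA : measurable (X @^-1` A) by rewrite -[X in measurable X]setTI; exact: mX.
have mU : measurable_fun setT (EFin \o (fun w => expR `|X w|)).
  by apply: measurable_EFin_expR; exact: measurableT_comp.
have mI : measurable_fun setT (EFin \o (\1_(~` (X @^-1` A)) : T -> R)).
  by apply/measurable_EFinP; apply: measurable_indic; exact: measurableC.
rewrite (eq_integral (fun w => (3/4)%:E + (1/4 : R)%:E * (\1_(~` (X @^-1` A)) w)%:E
   + beta%:E * (expR `|X w|)%:E)%E); last first.
  by move=> w _; rewrite /lyapunov !EFinD !EFinM.
have m1 : measurable_fun setT (fun w => (1/4 : R)%:E * (\1_(~` (X @^-1` A)) w)%:E)%E.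
  exact: measurable_funeM.
have m2 : measurable_fun setT (fun w => beta%:E * (expR `|X w|)%:E)%E.
  exact: measurable_funeM.
rewrite ge0_integralD//; last 3 first.
- by move=> w _; rewrite -EFinM -EFinD lee_fin addr_ge0// mulr_ge0.
- by apply: emeasurable_funD.
- by move=> w _; rewrite -EFinM lee_fin mulr_ge0 ?expR_ge0.
rewrite ge0_integralD//.
rewrite ge0_integralZl//.
rewrite ge0_integralZl//.
rewrite integral_indic//; last exact: measurableC.
rewrite setIT [X in (_ + _ * X + _)%E](probability_setC P mXA).
rewrite [X in (X + _ + _)%E](integral_cst P measurableT (3/4)%:E).
rewrite [X in (_ * X + _ + _)%E]probability_setT mule1.
have -> : 1 - p / 4 + beta * u = 3 / 4 + 1/4 * (1 - p) + beta * u by lra.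
rewrite !EFinD; apply: leeD; last by rewrite EFinM; apply: lee_wpmul2l.
rewrite leeD2l// [leRHS]EFinM; apply: lee_wpmul2l => //.
by rewrite EFinB leeB.
Qed.

Context (Y : T -> R) (mY : measurable_fun setT Y).
Context (gamma mu sigma : R -> R).
Context (dY : is_density P Y gamma)
  (gammaK : forall K : set R, compact K ->
     exists m M : R, 0 < m /\ forall x, K x -> m <= gamma x <= M)
  (muK : forall K : set R, compact K -> exists M : R, forall x, K x -> `|mu x| <= M)
  (sigma0 : forall x, 0 < sigma x)
  (sigmaK : forall K : set R, compact K ->
     exists m : R, 0 < m /\ forall x, K x -> m <= sigma x).
Context (M : R) (sigmaM : forall x, sigma x <= M).

Let segment_absP (r x : R) : (`[- r, r]%classic x) <-> `|x| <= r.
Proof. by rewrite /= in_itv/= ler_norml. Qed.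

(** From [|x| <= r], landing in the bounded set [A] forces the noise into a fixed compact interval,
    where [gamma] is bounded below. *)
Lemma hitting_uniform (A : set R) (n r : R) : measurable A ->
  (0 < lebesgue_measure A)%E -> (forall x, A x -> `|x| <= n) ->
  exists p : R, [/\ 0 < p, p <= 1 &
    forall x, `|x| <= r -> (p%:E <= P [set w | A (x + mu x + sigma x * Y w)%R])%E].
Proof.
move=> mA A0 An.
have [Mm HMm] := muK `[- r, r]%classic (@segment_compact R (- r) r).
have [s0 [s00 Hs0]] := sigmaK `[- r, r]%classic (@segment_compact R (- r) r).
(* Landing in [A] means [sigma x |y| <= n + |x + mu x| <= n + r + Mm], and [sigma x >= s0]. *)
pose b := (n + (r + Mm)) / s0.
have [g0 [G [g00 Hg]]] := gammaK `[- b, b]%classic (@segment_compact R (- b) b).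
have M0 : 0 < M by exact: lt_le_trans (sigma0 0) (sigmaM 0).
pose q : \bar R := ((g0 / M)%:E * lebesgue_measure A)%E.
have q0 : (0 < q)%E by rewrite mule_gt0// lte_fin divr_gt0.
have hit x : `|x| <= r -> (q <= P [set w | A (x + mu x + sigma x * Y w)%R])%E.
  move=> xr; apply: (@affine_hitting_lower_bound R d T P Y gamma) => //; first exact: ltW.
    by rewrite sigma0 sigmaM.
  move=> y Ay; apply: (andP (Hg y _)).1; apply/segment_absP.
  have xr' : `[- r, r]%classic x by apply/segment_absP.
  have h1 := An _ Ay; have h2 := HMm _ xr'; have h3 := Hs0 _ xr'.
  rewrite /b ler_pdivlMr//.
  have h4 : sigma x * `|y| <= n + (r + Mm).
    rewrite -[sigma x]gtr0_norm// -normrM.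
    have -> : sigma x * y = (x + mu x + sigma x * y) - (x + mu x) by ring.
    by apply: le_trans (ler_normB _ _) _; apply: lerD => //; apply: le_trans (ler_normD _ _) _; exact: lerD.
  by rewrite mulrC; apply: le_trans h4; rewrite ler_wpM2r.
(* The bound [q] is an extended real; it is truncated to a real number in []0, 1]]. *)
have [p [p0 p1 pq]] : exists p : R, [/\ 0 < p, p <= 1 & (p%:E <= q)%E].
  case: (q) q0 => [c|_|//]; last by exists 1; rewrite leey.
  rewrite lte_fin => c0; exists (Num.min c 1).
  by rewrite lt_min c0 ltr01 lee_fin !ge_min !lexx orbT.
by exists p; split=> // x xr; exact: le_trans pq (hit x xr).
Qed.

Context (mmu : measurable_fun setT mu) (msigma : measurable_fun setT sigma).
Context (q r0 : R) (q1 : q < 1)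
  (muq : forall x, r0 < `|x| -> `|x + mu x| / `|x| <= q).
Context (B : R) (B0 : 0 <= B)
  (YB : (\int[P]_w (expR (M * `|Y w|))%:E <= B%:E)%E).

Let measurable_step x : measurable_fun setT (fun w => x + mu x + sigma x * Y w).
Proof. by apply: measurable_funD => //; exact: measurable_funM. Qed.

Lemma exp_abs_step_le x :
  (\int[P]_w (expR `|x + mu x + sigma x * Y w|)%:E <= (expR `|x + mu x|%R * B)%:E)%E.
Proof.
apply: (@le_trans _ _ (\int[P]_w ((expR `|x + mu x|)%:E * (expR (M * `|Y w|))%:E))%E).
  apply: ge0_le_integral => //.
  - by apply: measurable_EFin_expR; exact: measurableT_comp.
  - apply: measurable_funeM; apply: measurable_EFin_expR.
    by apply: measurable_funM => //; exact: measurableT_comp.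
  move=> w _; rewrite -EFinM -expRD lee_fin ler_expR.
  apply: le_trans (ler_normD _ _) _; rewrite lerD2l normrM gtr0_norm//.
  by rewrite ler_wpM2r.
rewrite ge0_integralZl//; last first.
  by apply: measurable_EFin_expR; apply: measurable_funM => //; exact: measurableT_comp.
by rewrite [leRHS]EFinM lee_wpmul2l// lee_fin expR_ge0.
Qed.

Lemma occupation_drift (A : set R) (n : R) : measurable A ->
  (0 < lebesgue_measure A)%E -> (forall x, A x -> `|x| <= n) ->
  exists beta rho : R, [/\ 0 <= beta, 0 < rho, rho < 1 &
    forall x, (\int[P]_w (expR (- \1_A x) *
       lyapunov A beta (x + mu x + sigma x * Y w))%:E
      <= (rho * lyapunov A beta x)%:E)%E].
Proof.
move=> mA A0 An.
have iq0 : 0 < 1 - q by rewrite subr_gt0.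
(* Beyond [r], [4 B <= (1 - q) |x| <= e^((1 - q) |x|)], so the mean of [e^|X_1|] is at most
   [e^|x| / 4]. The other summands ensure that (A3) applies there and that [A] lies within radius
   [r]. *)
pose r := `|r0| + `|n| + 4 * B / (1 - q).
have rB : 0 <= 4 * B / (1 - q) by rewrite divr_ge0 ?mulr_ge0// ltW.
have rn : n <= r.
  by have := ler_norm n; have := normr_ge0 r0; rewrite /r; lra.
have rr0 : r0 <= r.
  by have := ler_norm r0; have := normr_ge0 n; rewrite /r; lra.
have r00 : 0 <= r by have := normr_ge0 r0; have := normr_ge0 n; rewrite /r; lra.
have [Mm HMm] := muK `[- r, r]%classic (@segment_compact R (- r) r).
have [p [p0 p1 hit]] := hitting_uniform A n r mA A0 An.
pose B1 := expR (r + Mm) * B.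
have B10 : 0 <= B1 by rewrite mulr_ge0 ?expR_ge0.
(* The exponential term costs [beta * B1 = p / 8 - beta], so the hitting gain [p / 4] pays for it
   with at least [beta] to spare. *)
pose beta := p / 8 / (B1 + 1).
have beta0 : 0 < beta by rewrite /beta divr_gt0 ?divr_gt0//; lra.
have betaE : beta * (B1 + 1) = p / 8.
  by rewrite /beta; field; rewrite gt_eqF//; lra.
have betaB : 0 <= beta * B1 by rewrite mulr_ge0// ltW.
have betap : beta + beta * B1 = p / 8 by rewrite -betaE; ring.
have near x : `|x| <= r -> (\int[P]_w (expR `|x + mu x + sigma x * Y w|)%:E <= B1%:E)%E.
  move=> xr; apply: le_trans (exp_abs_step_le x) _.
  rewrite lee_fin ler_wpM2r// ler_expR; apply: le_trans (ler_normD _ _) _.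
  by rewrite lerD//; apply: HMm; apply/segment_absP.
have far x : r < `|x| ->
    (\int[P]_w (expR `|x + mu x + sigma x * Y w|)%:E <= (expR `|x| / 4)%:E)%E.
  move=> xr; apply: le_trans (exp_abs_step_le x) _; rewrite lee_fin.
  have x0 : 0 < `|x| by exact: le_lt_trans xr.
  have := muq x (le_lt_trans rr0 xr); rewrite ler_pdivrMr// => h1.
  have h2 : 4 * B <= expR ((1 - q) * `|x|).
    have h3 : 4 * B / (1 - q) <= `|x|.
      by apply: le_trans (ltW xr); have := normr_ge0 r0; have := normr_ge0 n; rewrite /r; lra.
    move: h3; rewrite ler_pdivrMr// => h3.
    by have := expR_ge1Dx ((1 - q) * `|x|); lra.
  have h3 : expR `|x + mu x| <= expR (q * `|x|) by rewrite ler_expR.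
  have -> : expR `|x| = expR (q * `|x|) * expR ((1 - q) * `|x|).
    by rewrite -expRD; congr expR; ring.
  have h4 : expR `|x + mu x| * B <= expR (q * `|x|) * B by rewrite ler_wpM2r.
  have h5 : expR (q * `|x|) * (4 * B) <= expR (q * `|x|) * expR ((1 - q) * `|x|).
    by rewrite ler_wpM2l ?expR_ge0.
  lra.
exists beta, (1 - beta / 4); split; [exact: ltW|lra|lra|].
move=> x.
have mstep : measurable_fun setT (EFin \o (fun w => lyapunov A beta (x + mu x + sigma x * Y w))).
  apply/measurable_EFinP; apply: (measurableT_comp (measurable_lyapunov A beta mA)).
  exact: measurable_step.
have beta0' : 0 <= beta by exact: ltW.
have W0 y : 0 <= lyapunov A beta y by apply: le_trans (lyapunov_ge A beta y beta0').
rewrite (eq_integral (fun w => (expR (- \1_A x))%:E *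
  (lyapunov A beta (x + mu x + sigma x * Y w)%R)%:E)%E); last by move=> w _; rewrite EFinM.
rewrite ge0_integralZl//; last by move=> w _; rewrite lee_fin.
have U1 : beta <= beta * expR `|x| by rewrite ler_peMr// -[leLHS]expR0 ler_expR.
have U0 : 0 <= beta * expR `|x| by exact: le_trans U1.
have e10 := expR_ge0 (- \1_A x : R).
have [xA|xA] := pselect (A x).
  have xr : `|x| <= r by exact: le_trans (An _ xA) rn.
  have I := @lyapunov_integral_le _ A beta p B1 (measurable_step x) mA beta0' (hit x xr) (near x xr).
  apply: le_trans (lee_wpmul2l _ I) _; first by rewrite lee_fin.
  rewrite -EFinM lee_fin (lyapunov_in xA) indicE mem_set//=.
  (* On [A] the Lyapunov function may drop to about [3 / 4], but the factor [1 / e <= 1 / 2] makes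
     up for it. *)
  have e1 : expR (- 1) <= 2^-1 :> R.
    rewrite expRN lef_pV2 ?posrE ?expR_gt0//.
    by have := expR_ge1Dx (1 : R); lra.
  have h1 : expR (- 1) * (1 - p / 4 + beta * B1) <= 2^-1 * (1 - p / 4 + beta * B1).
    by rewrite ler_wpM2r//; lra.
  have h2 : (1 - beta / 4) * (3 / 4) <= (1 - beta / 4) * (3 / 4 + beta * expR `|x|).
    by rewrite ler_wpM2l ?lerDl//; lra.
  lra.
(* Off [A] there is no exponential factor: for [|x| <= r] the decrease comes from hitting [A],
   farther out from the contraction of [e^|x|]. *)
have [xr|xr] := lerP `|x| r.
  have I := @lyapunov_integral_le _ A beta p B1 (measurable_step x) mA beta0' (hit x xr) (near x xr).
  apply: le_trans (lee_wpmul2l _ I) _; first by rewrite lee_fin.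
  rewrite -EFinM lee_fin (lyapunov_notin xA) indicE memNset//= oppr0 expR0 mul1r.
  have h2 : (1 - beta / 4) * 1 <= (1 - beta / 4) * (1 + beta * expR `|x|).
    by rewrite ler_wpM2l ?lerDl//; lra.
  lra.
have I : (\int[P]_w (lyapunov A beta (x + mu x + sigma x * Y w))%:E <= (1 - 0 / 4 + beta * (expR `|x| / 4))%:E)%E.
  by apply: lyapunov_integral_le => //; exact: far.
apply: le_trans (lee_wpmul2l _ I) _; first by rewrite lee_fin.
rewrite -EFinM lee_fin (lyapunov_notin xA) indicE memNset//= oppr0 expR0 mul1r.
have h2 : beta * (beta * expR `|x|) <= 1/8 * (beta * expR `|x|).
  by rewrite ler_wpM2r//; lra.
lra.
Qed.

End drift.

(** * Additive functionals *)

Section additive_functional.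
Context {R : realType} {d : measure_display} {T : measurableType d}.
Context (P : probability T R) (mu sigma : R -> R) (eps : nat -> T -> R) (x0 : R).
Context (mmu : measurable_fun setT mu) (msigma : measurable_fun setT sigma).
Context (iid : iid_from1 P eps).

Local Notation X := (Xproc mu sigma eps x0).

Fixpoint additive_functional (g : R * R -> R) (t : nat) (w : T) : R :=
  match t with
  | 0%N => 0
  | t'.+1 => additive_functional g t' w + g (X t' w, eps t'.+1 w)
  end.

(** With the running sum as second coordinate, an additive functional is read off a chain driven by
    the same noise. *)
Definition additive_step (g : R * R -> R) (z : (R * R) * R) : R * R :=
  (z.1.1 + mu z.1.1 + sigma z.1.1 * z.2, z.1.2 + g (z.1.1, z.2)).

Lemma chain_additive_step g t w :
  chain (additive_step g) (x0, 0) eps t w = (X t w, additive_functional g t w).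
Proof. by elim: t => [//|t IH] /=; rewrite IH. Qed.

Lemma measurable_additive_step g : measurable_fun setT g ->
  measurable_fun setT (additive_step g).
Proof.
move=> mg.
have m11 : measurable_fun setT (fun z : (R * R) * R => z.1.1).
  by apply: (measurableT_comp measurable_fst); exact: measurable_fst.
have m12 : measurable_fun setT (fun z : (R * R) * R => z.1.2).
  by apply: (measurableT_comp measurable_snd); exact: measurable_fst.
have m2 : measurable_fun setT (fun z : (R * R) * R => z.2) by exact: measurable_snd.
apply: measurable_fun_pair.
  apply: measurable_funD.
    by apply: measurable_funD => //; exact: measurableT_comp.
  by apply: measurable_funM => //; exact: (measurableT_comp msigma).
apply: measurable_funD => //; apply: (measurableT_comp mg).
exact: measurable_fun_pair.
Qed.

Lemma measurable_additive_functional g t : measurable_fun setT g ->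
  measurable_fun setT (additive_functional g t).
Proof.
move=> /measurable_additive_step mg.
have := measurableT_comp measurable_snd (measurable_chain P (x0, 0 : R) mg iid t).
by apply: eq_measurable_fun => w _ /=; rewrite chain_additive_step.
Qed.

Lemma measurable_Xproc t : measurable_fun setT (X t).
Proof.
have mg : measurable_fun setT (cst 0 : R * R -> R) by exact: measurable_cst.
have := measurableT_comp measurable_fst
  (measurable_chain P (x0, 0 : R) (measurable_additive_step (cst 0) mg) iid t).
by apply: eq_measurable_fun => w _ /=; rewrite chain_additive_step.
Qed.

(** Chernoff bound with a weight: the drift inequality makes [e^(- theta n) W(x)] contract by [rho]
    in mean along the pair chain, and Markov's inequality is applied at level [e^(- theta a) w0]. *)
Lemma additive_functional_tail (g : R * R -> R) (W : R -> R) (theta rho w0 a : R) t :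
  measurable_fun setT g -> measurable_fun setT W -> 0 < w0 ->
  (forall x, w0 <= W x) -> 0 <= theta -> 0 <= rho ->
  (forall x, (\int[P]_w (expR (- (theta * g (x, eps 1%N w))) *
       W (x + mu x + sigma x * eps 1%N w))%:E <= (rho * W x)%:E)%E) ->
  (P [set w | (additive_functional g t w <= a)%R] <=
   (expR (theta * a) * rho ^+ t * (W x0 / w0))%:E)%E.
Proof.
move=> mg mW w00 Ww theta0 rho0 drift.
have W0 x : 0 <= W x by exact: le_trans (ltW w00) (Ww x).
pose H (z : R * R) := expR (- (theta * z.2)) * W z.1.
have mH : measurable_fun setT H.
  apply: measurable_funM; last exact: (measurableT_comp mW measurable_fst).
  apply: measurableT_comp => //; apply: measurableT_comp => //.
  by apply: measurable_funM => //; exact: measurable_snd.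
have H0 z : 0 <= H z by rewrite mulr_ge0 ?expR_ge0.
have m1 := iid.1 1%N isT.
have dH z : (\int[P]_w (H (additive_step g (z, eps 1%N w)))%:E <= (rho * H z)%:E)%E.
  case: z => x n; rewrite /H /=.
  rewrite (eq_integral (fun w => ((expR (- (theta * n)))%:E *
    (expR (- (theta * g (x, eps 1%N w))) * W (x + mu x + sigma x * eps 1%N w)%R)%:E)%E)); last first.
    by move=> w _; rewrite mulrDr opprD expRD -mulrA EFinM.
  rewrite ge0_integralZl//; last 2 first.
  - apply/measurable_EFinP; apply: measurable_funM.
      do 2 apply: measurableT_comp => //; apply: measurable_funM => //.
      by apply: (measurableT_comp mg); exact: measurable_fun_pair.
    apply: (measurableT_comp mW); apply: measurable_funD => //.
    exact: measurable_funM.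
  - by move=> w _; rewrite lee_fin mulr_ge0 ?expR_ge0.
  apply: le_trans (lee_wpmul2l _ (drift x)) _; first by rewrite lee_fin expR_ge0.
  by rewrite -EFinM lee_fin mulrCA.
have mstep := measurable_additive_step g mg.
have I := @chain_integral_geometric _ _ _ _ _ P _ (x0, 0 : R) eps mstep iid t H rho mH H0 rho0 dH.
have mHZ : measurable_fun setT (fun w => H (chain (additive_step g) (x0, 0) eps t w)).
  by apply: (measurableT_comp mH); exact: (measurable_chain P _ mstep iid).
have c0 : 0 < expR (- (theta * a)) * w0 by rewrite mulr_gt0 ?expR_gt0.
have := le_trans (markov_ge0 P _ _ mHZ (fun=> H0 _) c0) I.
rewrite -lee_pdivlMl// => Q; apply: le_trans (le_trans _ Q) _; last first.
  rewrite -EFinM lee_fin /H /= mulr0 oppr0 expR0 mul1r expRN invfM invrK.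
  by rewrite le_eqVlt; apply/orP; left; apply/eqP; ring.
apply: le_measure; rewrite ?inE.
- by apply: measurable_setle => //; exact: measurable_additive_functional.
- exact: measurable_setle.
move=> w /= na; rewrite chain_additive_step /H /=; apply: ler_pM => //.
- exact: ltW.
- by rewrite ler_expR lerN2 ler_wpM2l.
Qed.

End additive_functional.

(** * Wealth of the strategy *)

Section wealth.
Context {R : realType} {d : measure_display} {T : measurableType d}.
Context (P : probability T R) (mu sigma : R -> R) (eps : nat -> T -> R) (x0 : R).

Local Notation X := (Xproc mu sigma eps x0).
Local Notation V := (wealth (Sproc X) (pi_plus mu X)).

Definition traded_noise (z : R * R) : R :=
  if 0 < mu z.1 then sigma z.1 * z.2 else 0.

(** While the stock is held, the log-return is [mu x] plus the traded noise, and
    [mu x >= delta 1_A(x)]. Otherwise wealth is constant, and [x] is outside [A], so neither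
    functional moves. *)
Lemma wealth_lower_bound (A : set R) (delta v0 : R) t w :
  0 <= delta -> 0 < v0 -> (forall x, A x -> delta < mu x) ->
  v0 * expR (delta * additive_functional mu sigma eps x0 (fun z => \1_A z.1) t w
    + additive_functional mu sigma eps x0 traded_noise t w) <= V v0 t w.
Proof.
move=> delta0 v00 Amu; elim: t => [|t IH] /=.
  by rewrite mulr0 addr0 expR0 mulr1.
set N := additive_functional _ _ _ _ _ t w in IH *.
set L := additive_functional _ _ _ _ _ t w in IH *.
set x := X t w.
have -> : delta * (N + \1_A x) + (L + traded_noise (x, eps t.+1 w)) =
  (delta * N + L) + (delta * \1_A x + traded_noise (x, eps t.+1 w)) by ring.
rewrite expRD mulrA; apply: ler_pM => //; rewrite ?mulr_ge0 ?expR_ge0 ?(ltW v00)//.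
rewrite /Sproc /pi_plus /traded_noise /= -/x.
have [mux|mux] := ltrP 0 (mu x).
  rewrite subrr add0r mul1r -expRB ler_expR -lerBrDr.
  have -> : x + mu x + sigma x * eps t.+1 w - x - sigma x * eps t.+1 w = mu x by ring.
  have [xA|xA] := pselect (A x).
    by rewrite indicE mem_set//= mulr1 ltW// Amu.
  by rewrite indicE memNset// mulr0 ltW.
rewrite subr0 mul0r addr0 indicE memNset; first by rewrite mulr0 addr0 expR0.
by move=> /Amu; rewrite ltNge (le_trans mux).
Qed.

Context (mmu : measurable_fun setT mu) (msigma : measurable_fun setT sigma).
Context (iid : iid_from1 P eps).

Lemma measurable_traded_noise : measurable_fun setT traded_noise.
Proof.
have m1 : measurable_fun setT (fun z : R * R => z.1) by exact: measurable_fst.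
have m2 : measurable_fun setT (fun z : R * R => z.2) by exact: measurable_snd.
apply: measurable_fun_ifT => //.
  by apply: measurable_fun_ltr => //; exact: (measurableT_comp mmu).
by apply: measurable_funM => //; exact: (measurableT_comp msigma).
Qed.

Lemma measurable_wealth v0 t : measurable_fun setT (V v0 t).
Proof.
have mX := measurable_Xproc P mu sigma eps x0 mmu msigma iid.
elim: t => [|t IH] /=; first exact: measurable_cst.
have mpi : measurable_fun setT (pi_plus mu X t.+1).
  apply: measurable_fun_ifT => //.
  by apply: measurable_fun_ltr => //; exact: measurableT_comp.
have -> : (fun w => V v0 t w * (1 - pi_plus mu X t.+1 w +
    pi_plus mu X t.+1 w * (Sproc X t.+1 w / Sproc X t w))) =
  (fun w => V v0 t w * (1 - pi_plus mu X t.+1 w +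
    pi_plus mu X t.+1 w * expR (X t.+1 w - X t w))).
  by apply/funext => w; rewrite expRB.
apply: measurable_funM => //; apply: measurable_funD; first exact: measurable_funB.
apply: measurable_funM => //; apply: measurableT_comp => //.
exact: measurable_funB.
Qed.

End wealth.

(** * Choice of the rates and combination of the two tail bounds *)

Theorem theoremt2p15 (R : realType) (d : measure_display) (T : measurableType d)
  (P : probability T R) (mu sigma : R -> R) (eps : nat -> T -> R) (x0 : R)
  (gamma : R -> R)
  (* measurability of the coefficients *)
  (Hmu_m : measurable_fun setT mu) (Hsigma_m : measurable_fun setT sigma)
  (* (eps_t)_{t >= 1} i.i.d. *)
  (Hiid : iid_from1 P eps)
  (* (A1) *)
  (Hdens : is_density P (eps 1%N) gamma)
  (HA1 : forall K : set R, compact K ->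
     exists m M : R, 0 < m /\ forall x, K x -> m <= gamma x <= M)
  (* (A2) *)
  (HA2mu : forall K : set R, compact K -> exists M : R, forall x, K x -> `|mu x| <= M)
  (HA2pos : forall x, 0 < sigma x)
  (HA2low : forall K : set R, compact K -> exists m : R, 0 < m /\ forall x, K x -> m <= sigma x)
  (HA2up : exists M : R, forall x, sigma x <= M)
  (* (A3) : limsup_{|x| -> oo} |x + mu x| / |x| < 1 *)
  (HA3 : exists q : R, q < 1 /\ exists r0 : R, forall x, r0 < `|x| -> `|x + mu x| / `|x| <= q)
  (* (A4) *)
  (HA4exp : exists kappa : R, 0 < kappa /\
     ('E_P[fun w => expR (kappa * eps 1%N w ^+ 2)] < +oo)%E)
  (HA4mean : ('E_P[eps 1%N] = 0)%E)
  (* (RC+) *)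
  (HRC : (0 < lebesgue_measure [set x : R | (0 < mu x)%R])%E)
  (v0 : R) (Hv0 : 0 < v0) :
  let X := Xproc mu sigma eps x0 in
  let V := wealth (Sproc X) (pi_plus mu X) v0 in
  exists b c : R, 0 < b /\ 0 < c /\
    exists t0 : nat, forall t : nat, (t0 <= t)%N ->
      ((1 - expR (- (c * t%:R)))%:E <= P [set w | (expR (b * t%:R) <= V t w)%R])%E.

Proof.
move=> X V; have m1 := Hiid.1 1%N isT.
have [M HM] := HA2up.
have [q [q1 [r0 Hq]]] := HA3.
have [kappa [kappa0 HK]] := HA4exp.
have [K0 HKE] : exists K : R, (\int[P]_w (expR (kappa * eps 1%N w ^+ 2))%:E <= K%:E)%E.
  exists (fine ('E_P[fun w => expR (kappa * eps 1%N w ^+ 2)])%E).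
  have E0 : (0 <= 'E_P[fun w => expR (kappa * eps 1%N w ^+ 2)])%E.
    by apply: expectation_ge0 => w; exact: expR_ge0.
  rewrite fineK ?ge0_fin_numE//.
  by rewrite unlock.
pose K := Num.max K0 0.
have K00 : 0 <= K by rewrite le_max lexx orbT.
have YK : (\int[P]_w (expR (kappa * eps 1%N w ^+ 2))%:E <= K%:E)%E.
  by apply: le_trans HKE _; rewrite lee_fin le_max lexx.
have [delta [n [delta0 n0 A0]]] := level_set_pos mu Hmu_m HRC.
set A := [set x : R | _] in A0.
have mA : measurable A.
  apply: measurableI; first exact: measurable_setlt.
  by apply: measurable_setle => //; exact: measurableT_comp.
have An x : A x -> `|x| <= n by case.
have Amu x : A x -> delta < mu x by case.
have YM := exp_abs_moment_le P (eps 1%N) kappa K m1 kappa0 YK M.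
have B0 : 0 <= expR (M ^+ 2 / (4 * kappa)) * K by rewrite mulr_ge0 ?expR_ge0.
have [beta [rho [beta0 rho0 rho1 drift]]] :=
  @occupation_drift R d T P (eps 1%N) m1 gamma mu sigma Hdens HA1 HA2mu HA2pos HA2low
    M HM q r0 q1 Hq _ B0 YM A n mA A0 An.
(* Half of the decay of [rho^t = e^(- 2 a t)] is spent on the threshold [a t] for the visits;
   [e^(- a t)] remains. *)
pose a := - ln rho / 2.
have a0 : 0 < a by rewrite divr_gt0// oppr_gt0 ln_lt0// rho0.
have rhoE : rho = expR (- (2 * a)).
  by rewrite -[LHS]lnK ?posrE//; congr expR; rewrite /a; field.
pose K' := 3 * M ^+ 2 / kappa * K.
have K'0 : 0 <= K' by apply: mulr_ge0 => //; apply: divr_ge0; [apply: mulr_ge0 => //; exact: sqr_ge0|exact: ltW].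
(* Three constraints on [theta]: [theta <= 1] gives [theta^2 <= theta]; the bound with [kappa] makes
   [mgf_le] applicable to [theta * sigma x]; the last one leaves [a * delta / 2 - theta * K' >= a *
   delta / 4]. *)
pose th0 := Num.min 1 (kappa / (3 * (M ^+ 2 + 1))).
pose theta := Num.min th0 (a * delta / (4 * (K' + 1))).
have ad0 : 0 < a * delta by rewrite mulr_gt0.
have M20 : 0 <= M ^+ 2 by exact: sqr_ge0.
have theta0 : 0 < theta.
  rewrite !lt_min ltr01 !divr_gt0//; first by rewrite mulr_gt0//; lra.
  by rewrite mulr_gt0//; lra.
have th0th : theta <= th0 by rewrite ge_min lexx.
have theta1 : theta <= 1 by apply: le_trans th0th _; rewrite ge_min lexx.
have thetaM : theta * (3 * (M ^+ 2 + 1)) <= kappa.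
  rewrite -ler_pdivlMr; last by rewrite mulr_gt0//; lra.
  by apply: le_trans th0th _; rewrite ge_min lexx orbT.
have thetaK : theta * (4 * (K' + 1)) <= a * delta.
  rewrite -ler_pdivlMr; last by rewrite mulr_gt0//; lra.
  by rewrite ge_min lexx orbT.
have s2 x : sigma x ^+ 2 <= M ^+ 2 by have := HM x; have := HA2pos x; nra.
have th2 : theta ^+ 2 <= theta by nra.
have noise x : (\int[P]_w (expR (- (theta * traded_noise mu sigma (x, eps 1%N w))) * 1)%:E
    <= ((1 + theta ^+ 2 * K') * 1)%:E)%E.
  rewrite mulr1; under eq_integral do rewrite mulr1.
  (* For a frozen state the traded noise is a multiple of [eps_1], possibly zero. *)
  pose u := if 0 < mu x then - (theta * sigma x) else 0.
  rewrite (eq_integral (fun w => (expR (u * eps 1%N w))%:E)); last first.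
    move=> w _; rewrite /traded_noise /u /=; case: ifP => _; congr (expR _)%:E; ring.
  have u2 : u ^+ 2 <= theta ^+ 2 * M ^+ 2.
    rewrite /u; case: ifP => _; last by rewrite expr0n/= mulr_ge0 ?sqr_ge0.
    by rewrite sqrrN exprMn ler_wpM2l ?sqr_ge0.
  have u3 : theta ^+ 2 * M ^+ 2 <= theta * M ^+ 2 by rewrite ler_wpM2r.
  have := mgf_le P (eps 1%N) kappa K m1 kappa0 YK u HA4mean.
  move=> /(_ _)/le_trans; apply; first by lra.
  rewrite lee_fin lerD2l.
  have -> : theta ^+ 2 * K' = 3 * (theta ^+ 2 * M ^+ 2) / kappa * K by rewrite /K'; ring.
  apply: ler_wpM2r => //; apply: ler_wpM2r; first by rewrite invr_ge0 ltW.
  by rewrite ler_pM2l.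
pose NN := additive_functional mu sigma eps x0 (fun z => \1_A z.1).
pose LL := additive_functional mu sigma eps x0 (traded_noise mu sigma).
have mg1 : measurable_fun setT (fun z : R * R => \1_A z.1 : R).
  by apply: (measurableT_comp (measurable_indic mA)); exact: measurable_fst.
have mg2 := measurable_traded_noise mu sigma Hmu_m Hsigma_m.
pose C1 := lyapunov A beta x0 / (3 / 4).
have C10 : 0 <= C1 by rewrite divr_ge0//; apply: le_trans (lyapunov_ge _ _ _ beta0).
pose e := theta * (a * delta / 4).
have e0 : 0 < e by rewrite mulr_gt0// divr_gt0.
(* [a] is the decay rate for too few visits, [e] the one for too negative a noise sum. *)
pose c0 := Num.min a e.
have c00 : 0 < c0 by rewrite lt_min a0 e0.
have q34 : 0 < 3 / 4 :> R by rewrite divr_gt0.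
have drift1 x : (\int[P]_w (expR (- (1 * \1_A x)) *
    lyapunov A beta (x + mu x + sigma x * eps 1%N w))%:E <= (rho * lyapunov A beta x)%:E)%E.
  by rewrite mul1r; exact: drift.
have rhoL0 : 0 <= 1 + theta ^+ 2 * K' by rewrite addr_ge0// mulr_ge0// sqr_ge0.
have tailN t : (P [set w | (NN t w <= a * t%:R)%R] <= (C1 * expR (- (c0 * t%:R)))%:E)%E.
  have := additive_functional_tail P mu sigma eps x0 Hmu_m Hsigma_m Hiid
    (fun z => \1_A z.1) (lyapunov A beta) 1 rho (3/4) (a * t%:R) t mg1
    (measurable_lyapunov A beta mA) q34 (fun x => lyapunov_ge A beta x beta0)
    ler01 (ltW rho0) drift1.
  move=> /le_trans; apply.
  rewrite lee_fin mulrC -/C1 ler_wpM2l// mul1r rhoE -expRM_natr -expRD ler_expR.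
  have -> : a * t%:R + - (2 * a) * t%:R = - (a * t%:R) by ring.
  by rewrite lerN2 ler_wpM2r// ge_min lexx.
have tailL t : (P [set w | (LL t w <= - (a * delta / 2) * t%:R)%R] <= (expR (- (c0 * t%:R)))%:E)%E.
  have := additive_functional_tail P mu sigma eps x0 Hmu_m Hsigma_m Hiid
    (traded_noise mu sigma) (cst 1) theta (1 + theta ^+ 2 * K') 1
    (- (a * delta / 2) * t%:R) t mg2 (measurable_cst _)
    ltr01 (fun=> lexx _) (ltW theta0) rhoL0 noise.
  move=> /le_trans; apply.
  rewrite lee_fin divr1 mulr1.
  have h1 : (1 + theta ^+ 2 * K') ^+ t <= expR (theta ^+ 2 * K' * t%:R).
    by rewrite expRM_natr lerXn2r ?nnegrE ?expR_ge0 ?expR_ge1Dx.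
  apply: le_trans (ler_wpM2l (expR_ge0 _) h1) _; rewrite -expRD ler_expR.
  have -> : theta * (- (a * delta / 2) * t%:R) + theta ^+ 2 * K' * t%:R =
     - (theta * (a * delta / 2 - theta * K') * t%:R) by ring.
  rewrite lerN2 ler_wpM2r//; apply: (@le_trans _ _ e); first by rewrite ge_min lexx orbT.
  by rewrite /e ler_pM2l//; lra.
(* On the good event the drift gains [a * delta * t] and the noise loses at most half of it. Half of
   the rest is the growth rate; the other half absorbs [ln v0]. *)
pose b := a * delta / 4.
have b0 : 0 < b by rewrite divr_gt0.
exists b, (c0 / 2); split=> //; split; first by rewrite divr_gt0.
(* The first summand lets half of the rate [c0] absorb the factor [C1 + 1], through
   [C1 + 1 <= 1 + c0 t / 2 <= e^(c0 t / 2)]; the second gives [- ln v0 <= b t]. *)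
exists (Num.bound (2 * C1 / c0 + `|ln v0| / b)) => t tt.
have Cc0 : 0 <= 2 * C1 / c0 by apply: divr_ge0; [exact: mulr_ge0|exact: ltW].
have lb0 : 0 <= `|ln v0| / b by apply: divr_ge0 => //; exact: ltW.
have tb : 2 * C1 / c0 + `|ln v0| / b <= t%:R.
  apply: le_trans (ltW (archi_boundP _)) _; last by rewrite ler_nat.
  exact: addr_ge0.
have tC : C1 <= c0 / 2 * t%:R.
  have : 2 * C1 / c0 <= t%:R by apply: le_trans tb; rewrite lerDl.
  by rewrite ler_pdivrMr//; lra.
have tv : - ln v0 <= b * t%:R.
  have : `|ln v0| / b <= t%:R by apply: le_trans tb; rewrite lerDr.
  rewrite ler_pdivrMr// => h; have := ler_norm (- ln v0); rewrite normrN; lra.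
have mN : measurable [set w | NN t w <= a * t%:R].
  by apply: measurable_setle => //; exact: (measurable_additive_functional P).
have mL : measurable [set w | LL t w <= - (a * delta / 2) * t%:R].
  by apply: measurable_setle => //; exact: (measurable_additive_functional P).
have mV : measurable [set w | expR (b * t%:R) <= V t w].
  by apply: measurable_setle => //; exact: (measurable_wealth P).
pose bad := [set w | NN t w <= a * t%:R] `|` [set w | LL t w <= - (a * delta / 2) * t%:R].
have mbad : measurable bad by exact: measurableU.
have Pbad : (P bad <= (expR (- (c0 / 2 * t%:R)))%:E)%E.
  apply: le_trans (measureU2 P mN mL) _.
  apply: le_trans (leeD (tailN t) (tailL t)) _; rewrite -EFinD lee_fin.
  have -> : - (c0 * t%:R) = - (c0 / 2 * t%:R) + - (c0 / 2 * t%:R) by field.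
  have h : (C1 + 1) * expR (- (c0 / 2 * t%:R)) <= 1.
    rewrite -[leRHS](expRxMexpNx_1 (c0 / 2 * t%:R)) ler_wpM2r ?expR_ge0//.
    by apply: le_trans (expR_ge1Dx _); lra.
  have := ler_wpM2r (expR_ge0 (- (c0 / 2 * t%:R))) h.
  by rewrite mul1r expRD; apply: le_trans; rewrite mulrDl mul1r mulrDl mulrA.
apply: (@le_trans _ _ (P (~` bad))).
  by rewrite probability_setC// EFinB leeB.
apply: le_measure; rewrite ?inE//; first exact: measurableC.
move=> w /= /not_orP[/negP + /negP]; rewrite -!ltNge => Nw Lw.
apply: le_trans (wealth_lower_bound mu sigma eps x0 A delta v0 t w (ltW delta0) Hv0 Amu).
rewrite -[v0]lnK ?posrE// -expRD ler_expR -/(NN t w) -/(LL t w).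
have : delta * (a * t%:R) <= delta * NN t w by rewrite ler_pM2l// ltW.
move: tv; rewrite /b; lra.
Qed.
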